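(* Let $Y$ be a real vector space and $F\subseteq Y$. Suppose $\succ$ is a (not necessarily strict) preference relation on $Y$ with pre-domination structure $\tilde D_\succ$, and let $D\subseteq Y$. (a) If $\tilde D_\succ(y)=D$ for all $y\in F$, then $\operatorname{Min}(F,\succ)=\operatorname{Eff}(F,D\setminus(-D))$. If, in this situation, $\succ$ is asymmetric or antisymmetric, then $\operatorname{Min}(F,\succ)=\operatorname{Eff}(F,D)$. (b) If $\tilde D_\succ(y)\subseteq D$ for all $y\in F$, then $\operatorname{Eff}(F,D)\subseteq\operatorname{Min}(F,\succ)$. (c) If $\succ$ is asymmetric or antisymmetric and $D\subseteq\tilde D_\succ(y)$ for all $y\in F$, then $\operatorname{Min}(F,\succ)\subseteq\operatorname{Eff}(F,D)$.
   Context: A (not necessarily strict) preference relation on $Y$ is here just a binary relation $\succ$ on $Y$ (no further axioms are imposed). Its pre-domination structure is the map $\tilde D_\succ:Y\to\mathcal{P}(Y)$, $\tilde D_\succ(y):=\{\tilde d\in Y\mid y-\tilde d\succ y\}$. For $F\subseteq Y$, $\operatorname{Min}(F,\succ):=\{y^0\in F\mid\forall y\in F:\ (y\succ y^0\Rightarrow y^0\succ y)\}$. For $F,D\subseteq Y$, $\operatorname{Eff}(F,D):=\{y^0\in F\mid F\cap(y^0-D)\subseteq\{y^0\}\}$. Asymmetric: $y^1\succ y^2$ implies not $y^2\succ y^1$. Antisymmetric: $y^1\succ y^2$ and $y^2\succ y^1$ imply $y^1=y^2$. *)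

(* Defs.v *)
From mathcomp Require Import all_boot all_algebra.
From mathcomp Require Import boolp classical_sets reals.
From Corelib Require Import RelationClasses.

Set Implicit Arguments.
Unset Strict Implicit.
Unset Printing Implicit Defensive.

Import GRing.Theory.

Local Open Scope classical_set_scope.
Local Open Scope ring_scope.

(* In the definitions below, [pref a b] reads "a \succ b", i.e. a is preferred
   to b. A preference relation is an arbitrary binary relation. *)

Definition predomination (R : realType) (Y : lmodType R)
    (pref : Y -> Y -> Prop) : Y -> set Y :=
  fun y => [set d | pref (y - d) y].

Definition Min (R : realType) (Y : lmodType R)
    (F : set Y) (pref : Y -> Y -> Prop) : set Y :=
  [set y0 | F y0 /\ forall y, F y -> pref y y0 -> pref y0 y].

Definition Eff (R : realType) (Y : lmodType R) (F D : set Y) : set Y :=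
  [set y0 | F y0 /\ F `&` [set y0 - d | d in D] `<=` [set y0]].

(* Main.v *)
Require Import Defs.
From mathcomp Require Import all_boot all_algebra.
From mathcomp Require Import boolp classical_sets reals.
From Corelib Require Import RelationClasses.

Local Open Scope classical_set_scope.
Local Open Scope ring_scope.

Import GRing.Theory.

(** Both optimality notions are conditions on the competitors [y] of a candidate
    [y0] in [F], and the substitution [d := y0 - y] translates between them:
    [y] is preferred to [y0] exactly when [d] lies in the pre-domination set at
    [y0], and [y0] is preferred to [y] exactly when [- d] lies in the one at
    [y].  So [y0] is minimal iff every such [d] is matched by [- d].

    Where the pre-domination sets on [F] all equal [D], an unmatched [d] is an
    element of [D `\` - D], and efficiency for [D `\` - D] forbids these for
    [y <> y0]; the competitor [y = y0] is harmless, since [d = 0] is always its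
    own match.  Efficiency for [D] itself forbids matched differences too.  It
    therefore implies minimality as soon as [D] is large enough
    ([Eff_subset_Min]); the converse needs a relation in which two mutually
    preferred points coincide ([Min_subset_Eff]), a consequence of asymmetry
    (vacuously) as well as of antisymmetry. *)

Section Optimality.
Variables (R : realType) (Y : lmodType R).
Implicit Types (F D : set Y) (pref : Y -> Y -> Prop).

Lemma predominationB pref y0 y : predomination pref y0 (y0 - y) = pref y y0.
Proof. by rewrite /predomination /= subKr. Qed.

(** Quantifying over competitors [y] rather than over elements [d] of [D] puts
    efficiency in the same form as minimality. *)
Lemma EffP F D y0 :
  Eff F D y0 <-> F y0 /\ forall y, F y -> D (y0 - y) -> y = y0.
Proof.
split=> -[Fy0 eff]; split=> //.
- by move=> y Fy Dy; apply: eff; split=> //; exists (y0 - y); rewrite ?subKr.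
- by move=> y [Fy [d Dd yE]]; apply: eff; rewrite // -yE subKr.
Qed.

Lemma oppr_imageE D d : [set - e | e in D] d = D (- d).
Proof.
apply/propext; split=> [[e De <-]|Dd]; first by rewrite opprK.
by exists (- d); rewrite ?opprK.
Qed.

Lemma Min_eq_Eff F D pref :
  (forall y, F y -> predomination pref y = D) ->
  Min F pref = Eff F (D `\` [set - d | d in D]).
Proof.
move=> DE.
have prefE y0 y : F y0 -> D (y0 - y) = pref y y0.
  by move=> Fy0; rewrite -(DE y0 Fy0) predominationB.
apply/seteqP; split=> y0.
- move=> [Fy0 min]; apply/EffP; split=> // y Fy [].
  rewrite oppr_imageE opprB !prefE // => yy0 ny0y.
  by case: ny0y; apply: min.
- move=> /EffP[Fy0 eff]; split=> // y Fy yy0; apply: contrapT => ny0y.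
  have yE : y = y0.
    by apply: eff => //; split; rewrite ?oppr_imageE ?opprB prefE.
  by apply: ny0y; rewrite yE in yy0 *.
Qed.

(** Every point preferred to an efficient [y0] is [y0] itself, and the
    implication required by minimality is trivial for it. *)
Lemma Eff_subset_Min F D pref :
  (forall y, F y -> predomination pref y `<=` D) -> Eff F D `<=` Min F pref.
Proof.
move=> sD y0 /EffP[Fy0 eff]; split=> // y Fy yy0.
have yE : y = y0 by apply: eff => //; apply: (sD y0 Fy0); rewrite predominationB.
by rewrite yE in yy0 *.
Qed.

Lemma Min_subset_Eff F D pref :
  (forall y1 y2, pref y1 y2 -> pref y2 y1 -> y1 = y2) ->
  (forall y, F y -> D `<=` predomination pref y) -> Min F pref `<=` Eff F D.
Proof.
move=> anti sD y0 [Fy0 min]; apply/EffP; split=> // y Fy /(sD _ Fy0).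
by rewrite predominationB => yy0; apply: anti => //; apply: min.
Qed.

End Optimality.

Theorem proposition15 (R : realType) (Y : lmodType R) (F : set Y)
    (pref : Y -> Y -> Prop) (D : set Y) :
  (* (a) *)
  ((forall y, F y -> predomination pref y = D) ->
     Min F pref = Eff F (D `\` [set - d | d in D]) /\
     (Asymmetric pref \/ Antisymmetric Y eq pref -> Min F pref = Eff F D)) /\
  (* (b) *)
  ((forall y, F y -> predomination pref y `<=` D) ->
     Eff F D `<=` Min F pref) /\
  (* (c) *)
  (Asymmetric pref \/ Antisymmetric Y eq pref ->
     (forall y, F y -> D `<=` predomination pref y) ->
     Min F pref `<=` Eff F D).
Proof.
have anti : Asymmetric pref \/ Antisymmetric Y eq pref ->
    forall y1 y2, pref y1 y2 -> pref y2 y1 -> y1 = y2.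
  by move=> [asym|antisym] y1 y2 p12 p21; [case: (asym _ _ p12 p21)|apply: antisym].
split; last by split=> [|/anti]; [apply: Eff_subset_Min|apply: Min_subset_Eff].
move=> DE; split=> [|/anti pref_anti]; first exact: Min_eq_Eff.
apply/seteqP; split.
- by apply: Min_subset_Eff => // y /DE ->.
- by apply: Eff_subset_Min => y /DE ->.
Qed.
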